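(* Let $(A,\cdot_A,\circ_A)$ be an anti-pre-Lie Poisson algebra and suppose that there is an anti-pre-Lie Poisson algebra structure $(A^*,\cdot_{A^*},\circ_{A^*})$ on the dual space $A^*$. Let $(A,\cdot_A,[-,-]_A)$ and $(A^*,\cdot_{A^*},[-,-]_{A^*})$ be the respective sub-adjacent transposed Poisson algebras. Let $\Delta,\delta:A\to A\otimes A$ be the linear duals of $\cdot_{A^*}$ and $\circ_{A^*}$ respectively. Then $(A,\cdot_A,\circ_A,\Delta,\delta)$ is an anti-pre-Lie Poisson bialgebra if and only if $(A,A^*,-\mathcal L^*_{\cdot_A},-\mathcal L^*_{\circ_A},-\mathcal L^*_{\cdot_{A^*}},-\mathcal L^*_{\circ_{A^*}})$ is a matched pair of transposed Poisson algebras.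
   Context: All vector spaces and algebras are finite-dimensional over an algebraically closed field $\mathbb K$ of characteristic zero. Transposed Poisson algebra $(A,\cdot,[-,-])$: $(A,\cdot)$ commutative associative, $(A,[-,-])$ Lie, and $2z\cdot[x,y]=[z\cdot x,y]+[x,z\cdot y]$. Anti-pre-Lie algebra $(A,\circ)$: with $[x,y]=x\circ y-y\circ x$, $x\circ(y\circ z)-y\circ(x\circ z)=[y,x]\circ z$ and $[x,y]\circ z+[y,z]\circ x+[z,x]\circ y=0$; then $[-,-]$ is a Lie bracket. Anti-pre-Lie Poisson algebra $(A,\cdot,\circ)$: $(A,\cdot)$ commutative associative, $(A,\circ)$ anti-pre-Lie, $2(x\circ y)\cdot z-2(y\circ x)\cdot z=y\cdot(x\circ z)-x\cdot(y\circ z)$ and $2x\circ(y\cdot z)=(z\cdot x)\circ y+z\cdot(x\circ y)$. Then $(A,\cdot,[-,-])$ is a transposed Poisson algebra, the sub-adjacent one. Notation: $\mathcal L_\cdot(x)y=x\cdot y$, $\mathcal L_\circ(x)y=x\circ y=\mathcal R_\circ(y)x$, $\mathrm{ad}(x)y=[x,y]$; for linear $\rho:A\to\mathrm{End}(V)$, $\langle\rho^*(x)u^*,v\rangle=-\langle u^*,\rho(x)v\rangle$. Linear duals: $\langle a^*\cdot_{A^*}b^*,x\rangle=\langle a^*\otimes b^*,\Delta(x)\rangle$, $\langle a^*\circ_{A^*}b^*,x\rangle=\langle a^*\otimes b^*,\delta(x)\rangle$. $\tau(x\otimes y)=y\otimes x$, $\xi(x\otimes y\otimes z)=y\otimes z\otimes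 x$. Anti-pre-Lie coalgebra $(A,\delta)$: $(\mathrm{id}^{\otimes3}-\tau\otimes\mathrm{id})(\mathrm{id}\otimes\delta)\delta=(\tau\otimes\mathrm{id}-\mathrm{id}^{\otimes3})(\delta\otimes\mathrm{id})\delta$ and $(\mathrm{id}^{\otimes3}+\xi+\xi^2)(\tau\otimes\mathrm{id}-\mathrm{id}^{\otimes3})(\delta\otimes\mathrm{id})\delta=0$. Anti-pre-Lie bialgebra $(A,\circ,\delta)$: $(A,\circ)$ anti-pre-Lie algebra, $(A,\delta)$ anti-pre-Lie coalgebra, and for all $x,y$: $(\mathrm{id}^{\otimes2}-\tau)\big(\delta(x\circ y)-(\mathcal L_\circ(x)\otimes\mathrm{id})\delta(y)-(\mathrm{id}\otimes\mathcal L_\circ(x))\delta(y)+(\mathrm{id}\otimes\mathcal R_\circ(y))\delta(x)\big)=0$, $\delta([x,y])=(\mathrm{id}\otimes\mathrm{ad}(x)-\mathcal L_\circ(x)\otimes\mathrm{id})\delta(y)-(\mathrm{id}\otimes\mathrm{ad}(y)-\mathcal L_\circ(y)\otimes\mathrm{id})\delta(x)$. Commutative and cocommutative infinitesimal bialgebra $(A,\cdot,\Delta)$: $(A,\cdot)$ commutative associative, $\tau\Delta=\Delta$, $(\mathrm{id}\otimes\Delta)\Delta=(\Delta\otimes\mathrm{id})\Delta$ (i.e. $(A,\Delta)$ is a cocommutative coassociative coalgebra), and $\Delta(x\cdot y)=(\mathcal L_\cdot(x)\otimes\mathrm{id})\Delta(y)+(\mathrm{id}\otimes\mathcal L_\cdot(y))\Delta(x)$.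 Anti-pre-Lie Poisson coalgebra $(A,\Delta,\delta)$: $(A,\Delta)$ is a cocommutative coassociative coalgebra, $(A,\delta)$ is an anti-pre-Lie coalgebra, and $2(\delta\otimes\mathrm{id})\Delta-2(\tau\otimes\mathrm{id})(\delta\otimes\mathrm{id})\Delta=(\tau\otimes\mathrm{id})(\mathrm{id}\otimes\delta)\Delta-(\mathrm{id}\otimes\delta)\Delta$, $2(\mathrm{id}\otimes\Delta)\delta=(\mathrm{id}\otimes\tau)(\Delta\otimes\mathrm{id})\delta+(\delta\otimes\mathrm{id})\Delta$. Anti-pre-Lie Poisson bialgebra $(A,\cdot,\circ,\Delta,\delta)$: $(A,\cdot,\circ)$ is an anti-pre-Lie Poisson algebra, $(A,\Delta,\delta)$ an anti-pre-Lie Poisson coalgebra, $(A,\cdot,\Delta)$ a commutative and cocommutative infinitesimal bialgebra, $(A,\circ,\delta)$ an anti-pre-Lie bialgebra, and for all $x,y\in A$: (B1) $2(\mathcal L_\circ(x)\otimes\mathrm{id})\Delta(y)-2(\mathrm{id}\otimes\mathcal L_\cdot(y))\delta(x)+\delta(x\cdot y)+(\mathcal L_\cdot(y)\otimes\mathrm{id})\delta(x)-(\mathrm{id}\otimes\mathrm{ad}(x))\Delta(y)=0$; (B2) $2\Delta([x,y])+(\mathrm{id}\otimes\mathrm{ad}(y))\Delta(x)-(\mathcal L_\cdot(x)\otimes\mathrm{id})\delta(y)-(\mathrm{id}\otimes\mathrm{ad}(x))\Delta(y)+(\mathcal L_\cdot(y)\otimes\mathrm{id})\delta(x)=0$; (B3)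 $2(\mathrm{id}\otimes\mathcal L_\cdot(y))\delta(x)-2(\mathcal L_\circ(x)\otimes\mathrm{id})\Delta(y)+\Delta(x\circ y)+(\mathcal R_\circ(y)\otimes\mathrm{id})\Delta(x)+\tau(\mathcal L_\cdot(x)\otimes\mathrm{id})\delta(y)-(\mathrm{id}\otimes\mathcal L_\cdot(x))\delta(y)=0$; (B4) $(\tau-\mathrm{id}^{\otimes2})\big(2\delta(x\cdot y)-(\mathcal L_\cdot(x)\otimes\mathrm{id})\delta(y)-(\mathrm{id}\otimes\mathcal L_\cdot(x))\delta(y)-(\mathrm{id}\otimes\mathcal R_\circ(y))\Delta(x)\big)=0$. Matched pair of commutative associative algebras $(A,B,\mu_A,\mu_B)$: $\mu_A:A\to\mathrm{End}(B)$, $\mu_B:B\to\mathrm{End}(A)$ are representations (multiplicative linear maps) with $\mu_A(x)(a\cdot_Bb)=(\mu_A(x)a)\cdot_Bb+\mu_A(\mu_B(a)x)b$ and $\mu_B(a)(x\cdot_Ay)=(\mu_B(a)x)\cdot_Ay+\mu_B(\mu_A(x)a)y$. Matched pair of Lie algebras $(A,B,\rho_A,\rho_B)$: $\rho_A:A\to\mathfrak{gl}(B)$, $\rho_B:B\to\mathfrak{gl}(A)$ are representations with $\rho_A(x)[a,b]_B-[\rho_A(x)a,b]_B-[a,\rho_A(x)b]_B+\rho_A(\rho_B(a)x)b-\rho_A(\rho_B(b)x)a=0$ and $\rho_B(a)[x,y]_A-[\rho_B(a)x,y]_A-[x,\rho_B(a)y]_A+\rho_B(\rho_A(x)a)y-\rho_B(\rho_A(y)a)x=0$.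 Representation $(\mu,\rho,V)$ of a transposed Poisson algebra: $\mu$ a representation of $(A,\cdot)$, $\rho$ of $(A,[-,-])$, $2\mu(x)\rho(y)=\rho(x\cdot y)+\rho(y)\mu(x)$, $2\mu([x,y])=\rho(x)\mu(y)-\rho(y)\mu(x)$. Matched pair of transposed Poisson algebras $(A,B,\mu_A,\rho_A,\mu_B,\rho_B)$: $(A,B,\mu_A,\mu_B)$ and $(A,B,\rho_A,\rho_B)$ are matched pairs of commutative associative and of Lie algebras; $(\mu_A,\rho_A,B)$, $(\mu_B,\rho_B,A)$ are representations of the transposed Poisson algebras $A$, $B$; and for all $x,y\in A$, $a,b\in B$: $2\mu_B(\rho_A(y)a)x-2x\cdot_A\rho_B(a)y=-\rho_B(a)(x\cdot_Ay)-\rho_B(\mu_A(x)a)y+[y,\mu_B(a)x]_A$; $2\mu_B(a)([x,y]_A)=[\mu_B(a)x,y]_A+\rho_B(\mu_A(x)a)y+[x,\mu_B(a)y]_A-\rho_B(\mu_A(y)a)x$; $2\mu_A(\rho_B(b)x)a-2a\cdot_B\rho_A(x)b=-\rho_A(x)(a\cdot_Bb)-\rho_A(\mu_B(a)x)b+[b,\mu_A(x)a]_B$; $2\mu_A(x)([a,b]_B)=[\mu_A(x)a,b]_B+\rho_A(\mu_B(a)x)b+[a,\mu_A(x)b]_B-\rho_A(\mu_B(b)x)a$. *)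

(* Defs.v *)
From HB Require Import structures.
From mathcomp Require Import all_boot all_order all_algebra.

Set Implicit Arguments.
Unset Strict Implicit.
Unset Printing Implicit Defensive.

Import GRing.Theory.
Local Open Scope ring_scope.

Reserved Notation "⟨ u , x ⟩" (at level 0, u, x at level 99).
Reserved Notation "f ⊗ g" (at level 40, left associativity).

Section Tensor.
Variable K : fieldType.
Implicit Types A B C D : vectType K.

(* K^o is K regarded as a one-dimensional vector space. *)
Definition dual A : vectType K := 'Hom(A, K^o).

Definition pairing A (u : dual A) (x : A) : K := (u : 'Hom(A, K^o)) x.
Notation "⟨ u , x ⟩" := (pairing u x).

Lemma pairing_linearl A (x : A) k (u v : dual A) :
  ⟨k *: u + v, x⟩ = k * ⟨u, x⟩ + ⟨v, x⟩.
Proof. by rewrite /pairing add_lfunE scale_lfunE. Qed.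

Lemma pairing_linearr A (u : dual A) k (x y : A) :
  ⟨u, k *: x + y⟩ = k * ⟨u, x⟩ + ⟨u, y⟩.
Proof. by rewrite /pairing linearP. Qed.

Lemma dual_ext A (u v : dual A) : (forall x, ⟨u, x⟩ = ⟨v, x⟩) -> u = v.
Proof. by move=> uv; apply/lfunP. Qed.

Lemma linfunP A B (f : A -> B) x : linear f -> linfun f x = f x.
Proof.
move=> lf; pose F := GRing.isLinear.Build K A B _ _ lf.
by pose G : {linear A -> B} := HB.pack f F; rewrite -[f]/(G : A -> B) lfunE.
Qed.

Definition mkdual A (f : A -> K) : dual A := linfun (f : A -> K^o).

Lemma mkdualE A (f : A -> K) x :
  (forall k u v, f (k *: u + v) = k * f u + f v) -> ⟨mkdual f, x⟩ = f x.
Proof. by move=> lf; rewrite /pairing linfunP. Qed.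

(* Matrices of coefficients with respect to chosen bases; tlift_tens and
   tensor_ext below are the universal property, so no later notion depends
   on the choice of bases. *)
Definition tensor A B : vectType K := 'M[K]_(\dim {:A}, \dim {:B}).

Definition stdv A (i : 'I_(\dim {:A})) : A := (vbasis {:A})`_i.
Definition stdc A (i : 'I_(\dim {:A})) : A -> K := coord (vbasis {:A}) i.

Definition tens A B (x : A) (y : B) : tensor A B :=
  \matrix_(i, j) (stdc i x * stdc j y).

Definition tlift_fun A B C (f : A -> B -> C) (t : tensor A B) : C :=
  \sum_i \sum_j (t : 'M[K]_(_, _)) i j *: f (stdv i) (stdv j).

(* The linear map x ⊗ y |-> f x y, for a bilinear f. *)
Definition tlift A B C (f : A -> B -> C) : 'Hom(tensor A B, C) :=
  linfun (tlift_fun f).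

Fact tlift_fun_linear A B C (f : A -> B -> C) : linear (tlift_fun f).
Proof.
move=> k s t; rewrite /tlift_fun scaler_sumr -big_split /=; apply: eq_bigr => i _.
rewrite scaler_sumr -big_split /=; apply: eq_bigr => j _.
by rewrite !mxE scalerDl scalerA.
Qed.
HB.instance Definition _ A B C (f : A -> B -> C) :=
  GRing.isLinear.Build K (tensor A B) C _ (tlift_fun f) (tlift_fun_linear f).

Lemma stdv_sum A (x : A) : x = \sum_i stdc i x *: stdv i.
Proof. exact: coord_vbasis (memvf x). Qed.

Lemma tlift_tens A B C (f : A -> B -> C) (x : A) (y : B) :
    (forall b, linear (fun a => f a b)) -> (forall a, linear (f a)) ->
  tlift f (tens x y) = f x y.
Proof.
move=> f1 f2; rewrite /tlift lfunE /= /tlift_fun.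
pose F1 b := GRing.isLinear.Build K A C _ _ (f1 b).
pose G1 b : {linear A -> C} := HB.pack (fun a => f a b) (F1 b).
pose F2 a := GRing.isLinear.Build K B C _ _ (f2 a).
pose G2 a : {linear B -> C} := HB.pack (f a) (F2 a).
have -> : f x y = \sum_i stdc i x *: f (stdv i) y.
  rewrite {1}(stdv_sum x) -[LHS]/(G1 y _) linear_sum /=.
  by apply: eq_bigr => i _; rewrite -[LHS]/(G1 y _) linearZ.
apply: eq_bigr => i _.
have -> : f (stdv i) y = \sum_j stdc j y *: f (stdv i) (stdv j).
  rewrite {1}(stdv_sum y) -[LHS]/(G2 _ _) linear_sum /=.
  by apply: eq_bigr => j _; rewrite -[LHS]/(G2 _ _) linearZ.
rewrite scaler_sumr; apply: eq_bigr => j _.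
by rewrite scalerA /tens mxE.
Qed.

Lemma tens_sum A B (t : tensor A B) :
  t = \sum_i \sum_j (t : 'M[K]_(_, _)) i j *: tens (stdv i) (stdv j).
Proof.
rewrite [LHS](@matrix_sum_delta K _ _ (t : 'M[K]_(_, _))).
apply: eq_bigr => i _; apply: eq_bigr => j _; congr (_ *: _).
apply/matrixP => k l; rewrite !mxE /stdc /stdv.
by rewrite !coord_free ?(basis_free (vbasisP _)) // -natrM mulnb -!val_eqE [k == i :> nat]eq_sym [l == j :> nat]eq_sym.
Qed.

Lemma tensor_ext A B C (f g : 'Hom(tensor A B, C)) :
  (forall x y, f (tens x y) = g (tens x y)) -> f = g.
Proof.
move=> fg; apply/lfunP => t; rewrite (tens_sum t) !linear_sum.
apply: eq_bigr => i _; rewrite !linear_sum; apply: eq_bigr => j _.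
by rewrite !linearZ /= fg.
Qed.

Lemma tens_linearl A B (y : B) : linear (fun x : A => tens x y).
Proof.
move=> k x x'; apply/matrixP => i j.
by rewrite !mxE /stdc linearP /= mulrDl mulrA.
Qed.

Lemma tens_linearr A B (x : A) : linear (tens x : B -> tensor A B).
Proof.
move=> k y y'; apply/matrixP => i j.
by rewrite !mxE /stdc linearP /= mulrDr mulrCA.
Qed.

Definition tmap A B C D (f : 'Hom(A, C)) (g : 'Hom(B, D)) :
    'Hom(tensor A B, tensor C D) :=
  tlift (fun x y => tens (f x) (g y)).

Lemma tmap_tens A B C D (f : 'Hom(A, C)) (g : 'Hom(B, D)) x y :
  tmap f g (tens x y) = tens (f x) (g y).
Proof.
rewrite tlift_tens // => [b|a] k u v /=.
  by rewrite linearP tens_linearl.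
by rewrite linearP tens_linearr.
Qed.

Definition tswap A B : 'Hom(tensor A B, tensor B A) :=
  tlift (fun x y => tens y x).

Lemma tswap_tens A B (x : A) (y : B) : tswap A B (tens x y) = tens y x.
Proof.
by rewrite tlift_tens // => [b|a] k u v; rewrite (tens_linearl, tens_linearr).
Qed.

Definition tassoc A B C : 'Hom(tensor A (tensor B C), tensor (tensor A B) C) :=
  tlift (fun x => tlift (fun y z => tens (tens x y) z)).

Definition tassocV A B C : 'Hom(tensor (tensor A B) C, tensor A (tensor B C)) :=
  tlift (fun t z => tlift (fun x y => tens x (tens y z)) t).

Lemma tassoc_tens A B C (x : A) (y : B) (z : C) :
  tassoc A B C (tens x (tens y z)) = tens (tens x y) z.
Proof.
have bil a : tlift (fun y z => tens (tens a y) z) (tens y z)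
    = tens (tens a y) z.
  by rewrite tlift_tens // => [c|b] k u v; rewrite ?tens_linearr ?tens_linearl.
rewrite tlift_tens ?bil // => [t|a] k u v; last by rewrite linearP.
rewrite !lfunE /= /tlift_fun scaler_sumr -big_split; apply: eq_bigr => i _.
rewrite /= scaler_sumr -big_split; apply: eq_bigr => j _ /=.
by rewrite !tens_linearl scalerDr !scalerA mulrC.
Qed.

Lemma tassocV_tens A B C (x : A) (y : B) (z : C) :
  tassocV A B C (tens (tens x y) z) = tens x (tens y z).
Proof.
rewrite tlift_tens => [|t|a] *; last first.
- move=> k u v; rewrite !lfunE /= /tlift_fun scaler_sumr -big_split.
  apply: eq_bigr => i _; rewrite /= scaler_sumr -big_split.
  by apply: eq_bigr => j _ /=; rewrite !tens_linearr scalerDr !scalerA mulrC.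
- by move=> k u v; rewrite linearP.
by rewrite tlift_tens // => [c|b] k u v; rewrite ?tens_linearl ?tens_linearr.
Qed.

(* Threefold tensors are read as (A ⊗ B) ⊗ C. *)
Definition id_tens A B C D (f : 'Hom(B, tensor C D)) :
    'Hom(tensor A B, tensor (tensor A C) D) :=
  (tassoc A C D \o tmap \1 f)%VF.

(* x ⊗ y ⊗ z |-> x ⊗ z ⊗ y *)
Definition id_tswap A B C :
    'Hom(tensor (tensor A B) C, tensor (tensor A C) B) :=
  (id_tens A (tswap B C) \o tassocV A B C)%VF.

(* x ⊗ y ⊗ z |-> y ⊗ z ⊗ x *)
Definition txi A B C : 'Hom(tensor (tensor A B) C, tensor (tensor B C) A) :=
  (tswap A (tensor B C) \o tassocV A B C)%VF.

Lemma id_tswap_tens A B C (x : A) (y : B) (z : C) :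
  id_tswap A B C (tens (tens x y) z) = tens (tens x z) y.
Proof.
by rewrite !comp_lfunE tassocV_tens tmap_tens id_lfunE tswap_tens tassoc_tens.
Qed.

Lemma txi_tens A B C (x : A) (y : B) (z : C) :
  txi A B C (tens (tens x y) z) = tens (tens y z) x.
Proof. by rewrite comp_lfunE tassocV_tens tswap_tens. Qed.

(* <a ⊗ b, t> *)
Definition tpair A B (a : dual A) (b : dual B) : dual (tensor A B) :=
  tlift (fun x y => ⟨a, x⟩ * ⟨b, y⟩ : K^o).

Lemma tpair_tens A B (a : dual A) (b : dual B) x y :
  ⟨tpair a b, tens x y⟩ = ⟨a, x⟩ * ⟨b, y⟩.
Proof.
rewrite /pairing tlift_tens // => c k u v; rewrite pairing_linearr.
  by rewrite mulrDl -mulrA.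
by rewrite mulrDr mulrCA.
Qed.

End Tensor.

Notation "⟨ u , x ⟩" := (pairing u x) : ring_scope.
Notation "f ⊗ g" := (tmap f g) : ring_scope.
Arguments tswap {K A B}.
Arguments id_tens {K A B C D}.
Arguments id_tswap {K A B C}.
Arguments txi {K A B C}.

Section LinearMaps.
Variable K : fieldType.
Implicit Types A B V W : vectType K.

(* A product on A is a linear map m : A -> End(A), with x·y = m x y. Thus m
   itself is the left multiplication operator, and lflip m the right one:
   lflip m y x = x·y. *)
Definition lflip_at A B V (m : 'Hom(A, 'Hom(B, V))) (y : B) : 'Hom(A, V) :=
  linfun (fun x => m x y).
Definition lflip A B V (m : 'Hom(A, 'Hom(B, V))) : 'Hom(B, 'Hom(A, V)) :=
  linfun (lflip_at m).

Lemma lflipE A B V (m : 'Hom(A, 'Hom(B, V))) x y : lflip m y x = m x y.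
Proof.
have E b a : lflip_at m b a = m a b.
  by rewrite linfunP // => k u v; rewrite linearP !lfunE /= !lfunE.
rewrite linfunP ?E // => k u v; apply/lfunP => a.
by rewrite !lfunE /= !lfunE /= !E linearP.
Qed.

Definition commutator A (m : 'Hom(A, 'End(A))) : 'Hom(A, 'End(A)) :=
  m - lflip m.

Lemma commutatorE A (m : 'Hom(A, 'End(A))) x y :
  commutator m x y = m x y - m y x.
Proof. by rewrite /commutator !(add_lfunE, opp_lfunE) lflipE. Qed.

Definition dual_op V (f : 'End(V)) : 'End(dual V) :=
  linfun (fun u : dual V => mkdual (fun v => - ⟨u, f v⟩)).
Definition dual_rep A V (rho : 'Hom(A, 'End(V))) : 'Hom(A, 'End(dual V)) :=
  linfun (fun x => dual_op (rho x)).

Lemma dual_repE A V (rho : 'Hom(A, 'End(V))) x (u : dual V) v :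
  ⟨dual_rep rho x u, v⟩ = - ⟨u, rho x v⟩.
Proof.
have E0 (f : 'End(V)) (w : dual V) z : ⟨mkdual (fun v => - ⟨w, f v⟩), z⟩
    = - ⟨w, f z⟩.
  by rewrite mkdualE // => k a b; rewrite linearP pairing_linearr opprD mulrN.
have E (f : 'End(V)) (w : dual V) z : ⟨dual_op f w, z⟩ = - ⟨w, f z⟩.
  rewrite linfunP // => k a b; apply: dual_ext => y.
  by rewrite pairing_linearl !E0 pairing_linearl opprD mulrN.
rewrite linfunP // => k a b; apply/lfunP => w; apply: dual_ext => z.
rewrite add_lfunE scale_lfunE pairing_linearl !E linearP.
by rewrite add_lfunE scale_lfunE pairing_linearr opprD mulrN.
Qed.

(* The canonical isomorphism V -> V**. *)
Definition evalv V : 'Hom(V, dual (dual V)) :=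
  linfun (fun v => mkdual (fun u : dual V => ⟨u, v⟩)).

Lemma evalvE V (v : V) (u : dual V) : ⟨evalv V v, u⟩ = ⟨u, v⟩.
Proof.
have E (w : V) (z : dual V) :
    ⟨mkdual (fun u : dual V => ⟨u, w⟩), z⟩ = ⟨z, w⟩.
  by rewrite mkdualE // => k a b; rewrite pairing_linearl.
rewrite linfunP ?E // => k a b; apply: dual_ext => w.
by rewrite pairing_linearl !E pairing_linearr.
Qed.

Lemma dual_sep V (v w : V) : (forall u : dual V, ⟨u, v⟩ = ⟨u, w⟩) -> v = w.
Proof.
move=> H; rewrite (stdv_sum v) (stdv_sum w); apply: eq_bigr => i _.
have := H (mkdual (stdc i)).
by rewrite !mkdualE => [->|k a b|k a b]; rewrite // /stdc linearP.
Qed.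

Lemma dual_dim V : \dim {:dual V} = \dim {:V}.
Proof. by rewrite !dimvf /dim /= muln1. Qed.

Lemma evalv_ker V : lker (evalv V) == 0%VS.
Proof.
by apply/lker0P => v w vw; apply: dual_sep => u; rewrite -(evalvE v) vw evalvE.
Qed.

Lemma evalvK V : cancel (evalv V) (evalv V)^-1%VF.
Proof. by move=> v; rewrite -comp_lfunE lker0_compVf ?evalv_ker ?id_lfunE. Qed.

Lemma evalvVK V : cancel (evalv V)^-1%VF (evalv V).
Proof.
move=> w; apply: limg_lfunVK; have -> : limg (evalv V) = fullv.
  apply/eqP; rewrite eqEdim subvf /= limg_dim_eq; last first.
    by rewrite (eqP (evalv_ker V)) capv0.
  by rewrite !dual_dim.
exact: memvf.
Qed.

(* The dual of a representation on V*, read on V instead of V** through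
   evalv. *)
Definition predual_rep A V (rho : 'Hom(A, 'End(dual V))) : 'Hom(A, 'End(V)) :=
  linfun (fun x => ((evalv V)^-1 \o dual_rep rho x \o evalv V)%VF).

Lemma predual_repE A V (rho : 'Hom(A, 'End(dual V))) x (u : dual V) (v : V) :
  ⟨u, predual_rep rho x v⟩ = - ⟨rho x u, v⟩.
Proof.
rewrite linfunP => [|k a b]; last first.
  apply/lfunP => w; rewrite [dual_rep rho _]linearP.
  rewrite add_lfunE scale_lfunE !comp_lfunE add_lfunE scale_lfunE.
  by rewrite linearP.
by rewrite !comp_lfunE -evalvE evalvVK dual_repE evalvE.
Qed.

(* D : A -> A ⊗ A is the linear dual of the product m on A*. *)
Definition linear_dual A (m : 'Hom(dual A, 'End(dual A)))
    (D : 'Hom(A, tensor A A)) : Prop :=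
  forall (a b : dual A) x, ⟨m a b, x⟩ = ⟨tpair a b, D x⟩.

Lemma linear_dual_exists A (m : 'Hom(dual A, 'End(dual A))) :
  exists D : 'Hom(A, tensor A A), linear_dual m D.
Proof.
pose e i := mkdual (@stdc K A i).
have eE i x : ⟨e i, x⟩ = stdc i x by rewrite mkdualE // /stdc => *; rewrite linearP.
have sumr (u : dual A) I (F : I -> A) r :
    ⟨u, \sum_(i <- r) F i⟩ = \sum_(i <- r) ⟨u, F i⟩.
  by rewrite /pairing linear_sum.
have suml x I (F : I -> dual A) r :
    ⟨\sum_(i <- r) F i, x⟩ = \sum_(i <- r) ⟨F i, x⟩.
  by rewrite /pairing sum_lfunE.
have zr (u : dual A) k x : ⟨u, k *: x⟩ = k * ⟨u, x⟩ by rewrite /pairing linearZ.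
have zl (u : dual A) k x : ⟨k *: u, x⟩ = k * ⟨u, x⟩ by rewrite /pairing scale_lfunE.
have edec (u : dual A) : u = \sum_i ⟨u, stdv i⟩ *: e i.
  apply: dual_ext => x; rewrite suml {1}(stdv_sum x) sumr.
  by apply: eq_bigr => i _; rewrite zr zl eE mulrC.
pose f x : tensor A A := \matrix_(i, j) ⟨m (e i) (e j), x⟩.
have fl : linear f by move=> k x y; apply/matrixP => i j; rewrite !mxE pairing_linearr.
exists (linfun f) => a b x; rewrite linfunP // (tens_sum (f x)) {1}(edec a).
rewrite /pairing linear_sum !sum_lfunE linear_sum; apply: eq_bigr => i _ /=.
rewrite linearZ !scale_lfunE {1}(edec b) !linear_sum sum_lfunE scaler_sumr.
apply: eq_bigr => j _; rewrite !linearZ !scale_lfunE mxE.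
rewrite -[RHS]/(⟨m (e i) (e j), x⟩ * ⟨tpair a b, tens (stdv i) (stdv j)⟩).
by rewrite tpair_tens mulrC -mulrA.
Qed.

Lemma linear_dual_unique A (m : 'Hom(dual A, 'End(dual A)))
    (D D' : 'Hom(A, tensor A A)) :
  linear_dual m D -> linear_dual m D' -> D = D'.
Proof.
pose e i := mkdual (@stdc K A i).
have eE i x : ⟨e i, x⟩ = stdc i x by rewrite mkdualE // /stdc => *; rewrite linearP.
have pE i j (t : tensor A A) :
    ⟨tpair (e i) (e j), t⟩ = (t : 'M[K]_(_, _)) i j.
  pose c (t : tensor A A) : K^o := (t : 'M[K]_(_, _)) i j.
  have cl : linear c by move=> k u v; rewrite /c !mxE.
  rewrite -[RHS](linfunP t cl); suff -> : tpair (e i) (e j) = linfun c by [].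
  apply: (@tensor_ext K A A K^o) => x y; rewrite (linfunP _ cl) -[LHS]/(⟨tpair (e i) (e j), tens x y⟩).
  by rewrite tpair_tens !eE /c mxE.
move=> hD hD'; apply/lfunP => x; apply/matrixP => i j.
by rewrite -!pE -hD hD'.
Qed.

End LinearMaps.

Section Algebras.
Variable K : fieldType.
Variable A : vectType K.
Implicit Types (dot br circ : 'Hom(A, 'End(A))) (x y z : A).

Record comm_assoc_algebra dot : Prop := CommAssocAlgebra {
  ca_comm : forall x y, dot x y = dot y x;
  ca_assoc : forall x y z, dot (dot x y) z = dot x (dot y z) }.

Record lie_algebra br : Prop := LieAlgebra {
  lie_alt : forall x, br x x = 0;
  lie_jacobi : forall x y z,
    br x (br y z) + br y (br z x) + br z (br x y) = 0 }.

Record transposed_poisson_algebra dot br : Prop := TransposedPoissonAlgebra {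
  tp_ca : comm_assoc_algebra dot;
  tp_lie : lie_algebra br;
  tp_compat : forall x y z,
    2 *: dot z (br x y) = br (dot z x) y + br x (dot z y) }.

Record anti_pre_lie_algebra circ : Prop := AntiPreLieAlgebra {
  apl_rep : forall x y z,
    circ x (circ y z) - circ y (circ x z) = circ (commutator circ y x) z;
  apl_cyc : forall x y z,
    circ (commutator circ x y) z + circ (commutator circ y z) x
      + circ (commutator circ z x) y = 0 }.

Record apl_poisson_algebra dot circ : Prop := AplPoissonAlgebra {
  aplp_ca : comm_assoc_algebra dot;
  aplp_apl : anti_pre_lie_algebra circ;
  aplp_compat1 : forall x y z,
    2 *: dot (circ x y) z - 2 *: dot (circ y x) z
      = dot y (circ x z) - dot x (circ y z);
  aplp_compat2 : forall x y z,
    2 *: circ x (dot y z) = circ (dot z x) y + dot z (circ x y) }.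

End Algebras.

Section Bialgebras.
Variable K : fieldType.
Variable A : vectType K.
Implicit Types (dot circ : 'Hom(A, 'End(A))).
Implicit Types (Delta delta : 'Hom(A, tensor A A)) (x y : A).

Local Notation id1 := (\1%VF : 'End(A)).
Local Notation tau := (@tswap K A A).

Record anti_pre_lie_coalgebra delta : Prop := AntiPreLieCoalgebra {
  aplc_rep :
    ((\1 - tau ⊗ id1) \o id_tens delta \o delta)%VF
      = ((tau ⊗ id1 - \1) \o (delta ⊗ id1) \o delta)%VF;
  aplc_cyc :
    ((\1 + txi + (txi \o txi)) \o (tau ⊗ id1 - \1) \o (delta ⊗ id1)
      \o delta)%VF = 0 }.

Record cocomm_coassoc_coalgebra Delta : Prop := CocommCoassocCoalgebra {
  cc_cocomm : (tau \o Delta)%VF = Delta;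
  cc_coassoc : (id_tens Delta \o Delta)%VF = ((Delta ⊗ id1) \o Delta)%VF }.

Record apl_poisson_coalgebra Delta delta : Prop := AplPoissonCoalgebra {
  aplpc_cc : cocomm_coassoc_coalgebra Delta;
  aplpc_apl : anti_pre_lie_coalgebra delta;
  aplpc_compat1 :
    2 *: ((delta ⊗ id1) \o Delta)%VF
      - 2 *: ((tau ⊗ id1) \o (delta ⊗ id1) \o Delta)%VF
    = ((tau ⊗ id1) \o id_tens delta \o Delta)%VF
      - (id_tens delta \o Delta)%VF;
  aplpc_compat2 :
    2 *: (id_tens Delta \o delta)%VF
    = (id_tswap \o (Delta ⊗ id1) \o delta)%VF + ((delta ⊗ id1) \o Delta)%VF }.

Record comm_cocomm_inf_bialgebra dot Delta : Prop := CommCocommInfBialgebra {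
  ib_ca : comm_assoc_algebra dot;
  ib_cc : cocomm_coassoc_coalgebra Delta;
  ib_compat : forall x y,
    Delta (dot x y)
    = (dot x ⊗ id1) (Delta y) + (id1 ⊗ dot y) (Delta x) }.

Record anti_pre_lie_bialgebra circ delta : Prop := AntiPreLieBialgebra {
  aplb_alg : anti_pre_lie_algebra circ;
  aplb_coalg : anti_pre_lie_coalgebra delta;
  aplb_compat1 : forall x y,
    (\1 - tau)%VF
      (delta (circ x y) - (circ x ⊗ id1) (delta y)
       - (id1 ⊗ circ x) (delta y)
       + (id1 ⊗ lflip circ y) (delta x)) = 0;
  aplb_compat2 : forall x y,
    delta (commutator circ x y)
    = (id1 ⊗ commutator circ x - circ x ⊗ id1)%VF (delta y)
      - (id1 ⊗ commutator circ y - circ y ⊗ id1)%VF (delta x) }.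

Record apl_poisson_bialgebra dot circ Delta delta : Prop :=
  AplPoissonBialgebra {
  aplpb_alg : apl_poisson_algebra dot circ;
  aplpb_coalg : apl_poisson_coalgebra Delta delta;
  aplpb_inf : comm_cocomm_inf_bialgebra dot Delta;
  aplpb_apl : anti_pre_lie_bialgebra circ delta;
  aplpb_B1 : forall x y,
    2 *: (circ x ⊗ id1) (Delta y) - 2 *: (id1 ⊗ dot y) (delta x)
      + delta (dot x y) + (dot y ⊗ id1) (delta x)
      - (id1 ⊗ commutator circ x) (Delta y) = 0;
  aplpb_B2 : forall x y,
    2 *: Delta (commutator circ x y) + (id1 ⊗ commutator circ y) (Delta x)
      - (dot x ⊗ id1) (delta y) - (id1 ⊗ commutator circ x) (Delta y)
      + (dot y ⊗ id1) (delta x) = 0;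
  aplpb_B3 : forall x y,
    2 *: (id1 ⊗ dot y) (delta x) - 2 *: (circ x ⊗ id1) (Delta y)
      + Delta (circ x y) + (lflip circ y ⊗ id1) (Delta x)
      + tau ((dot x ⊗ id1) (delta y)) - (id1 ⊗ dot x) (delta y) = 0;
  aplpb_B4 : forall x y,
    (tau - \1)%VF
      (2 *: delta (dot x y) - (dot x ⊗ id1) (delta y)
       - (id1 ⊗ dot x) (delta y)
       - (id1 ⊗ lflip circ y) (Delta x)) = 0 }.

End Bialgebras.

Section Representations.
Variables (K : fieldType) (A V : vectType K).
Implicit Types (dot br : 'Hom(A, 'End(A))) (mu rho : 'Hom(A, 'End(V))).

Definition ca_representation dot mu : Prop :=
  forall x y, mu (dot x y) = (mu x \o mu y)%VF.

Definition lie_representation br rho : Prop :=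
  forall x y, rho (br x y) = (rho x \o rho y)%VF - (rho y \o rho x)%VF.

Record tp_representation dot br mu rho : Prop := TpRepresentation {
  tpr_ca : ca_representation dot mu;
  tpr_lie : lie_representation br rho;
  tpr_compat1 : forall x y,
    2 *: (mu x \o rho y)%VF = rho (dot x y) + (rho y \o mu x)%VF;
  tpr_compat2 : forall x y,
    2 *: mu (br x y) = (rho x \o mu y)%VF - (rho y \o mu x)%VF }.

End Representations.

Section MatchedPairs.
Variables (K : fieldType) (A B : vectType K).
Implicit Types (dotA brA : 'Hom(A, 'End(A))) (dotB brB : 'Hom(B, 'End(B))).
Implicit Types (muA rhoA : 'Hom(A, 'End(B))) (muB rhoB : 'Hom(B, 'End(A))).
Implicit Types (x y : A) (a b : B).

Record ca_matched_pair dotA dotB muA muB : Prop := CaMatchedPair {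
  cam_A : comm_assoc_algebra dotA;
  cam_B : comm_assoc_algebra dotB;
  cam_repA : ca_representation dotA muA;
  cam_repB : ca_representation dotB muB;
  cam_compatA : forall x a b,
    muA x (dotB a b) = dotB (muA x a) b + muA (muB a x) b;
  cam_compatB : forall a x y,
    muB a (dotA x y) = dotA (muB a x) y + muB (muA x a) y }.

Record lie_matched_pair brA brB rhoA rhoB : Prop := LieMatchedPair {
  liem_A : lie_algebra brA;
  liem_B : lie_algebra brB;
  liem_repA : lie_representation brA rhoA;
  liem_repB : lie_representation brB rhoB;
  liem_compatA : forall x a b,
    rhoA x (brB a b) - brB (rhoA x a) b - brB a (rhoA x b)
      + rhoA (rhoB a x) b - rhoA (rhoB b x) a = 0;
  liem_compatB : forall a x y,
    rhoB a (brA x y) - brA (rhoB a x) y - brA x (rhoB a y)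
      + rhoB (rhoA x a) y - rhoB (rhoA y a) x = 0 }.

Record tp_matched_pair dotA brA dotB brB muA rhoA muB rhoB : Prop :=
  TpMatchedPair {
  tpm_A : transposed_poisson_algebra dotA brA;
  tpm_B : transposed_poisson_algebra dotB brB;
  tpm_ca : ca_matched_pair dotA dotB muA muB;
  tpm_lie : lie_matched_pair brA brB rhoA rhoB;
  tpm_repA : tp_representation dotA brA muA rhoA;
  tpm_repB : tp_representation dotB brB muB rhoB;
  tpm_compat1 : forall x y a,
    2 *: muB (rhoA y a) x - 2 *: dotA x (rhoB a y)
    = - rhoB a (dotA x y) - rhoB (muA x a) y + brA y (muB a x);
  tpm_compat2 : forall x y a,
    2 *: muB a (brA x y)
    = brA (muB a x) y + rhoB (muA x a) y + brA x (muB a y) - rhoB (muA y a) x;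
  tpm_compat3 : forall x a b,
    2 *: muA (rhoB b x) a - 2 *: dotB a (rhoA x b)
    = - rhoA x (dotB a b) - rhoA (muB a x) b + brB b (muA x a);
  tpm_compat4 : forall x a b,
    2 *: muA x (brB a b)
    = brB (muA x a) b + rhoA (muB a x) b + brB a (muA x b) - rhoA (muB b x) a }.

End MatchedPairs.

(* Main.v *)
Require Import Defs.
From mathcomp Require Import all_boot all_order all_algebra.
From mathcomp Require Import ring.
Set Implicit Arguments.
Unset Strict Implicit.
Unset Printing Implicit Defensive.
Import GRing.Theory.
Local Open Scope ring_scope.

(* Pairing an identity in A ⊗ A with a ⊗ b, and an identity in A or A* with a
   vector of the dual space, turns both sides of the equivalence into scalar
   identities in ⟨a ·* b, x⟩ and ⟨a ∘* b, x⟩. Moving every operator of A onto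
   A* by transposition, the eight compatibility conditions of the bialgebra
   match those of the matched pair one by one: the infinitesimal condition
   gives both conditions on the commutative algebras, the two anti-pre-Lie
   conditions those on the Lie algebras, and (B1)-(B4) the four mixed ones.
   All remaining axioms hold on both sides, since they only express that A and
   A* are anti-pre-Lie Poisson algebras. *)

(** * Transposition under the pairing, and separation of tensors by product functionals *)

Section Pairing.
Variable K : fieldType.
Implicit Types A B C D V : vectType K.

Lemma lfunD A B (f : 'Hom(A, B)) x y : f (x + y) = f x + f y.
Proof. exact: linearD. Qed.

Lemma lfunN A B (f : 'Hom(A, B)) x : f (- x) = - f x.
Proof. exact: linearN. Qed.

Lemma lfunZ A B (f : 'Hom(A, B)) k x : f (k *: x) = k *: f x.
Proof. exact: linearZ. Qed.

Lemma pairingDl A (u v : dual A) x : ⟨u + v, x⟩ = ⟨u, x⟩ + ⟨v, x⟩.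
Proof. by rewrite /pairing add_lfunE. Qed.

Lemma pairingNl A (u : dual A) x : ⟨- u, x⟩ = - ⟨u, x⟩.
Proof. by rewrite /pairing opp_lfunE. Qed.

Lemma pairingZl A k (u : dual A) x : ⟨k *: u, x⟩ = k * ⟨u, x⟩.
Proof. by rewrite /pairing scale_lfunE. Qed.

Lemma pairing0l A (x : A) : ⟨0 : dual A, x⟩ = 0.
Proof. by rewrite /pairing zero_lfunE. Qed.

Lemma pairingDr A (u : dual A) x y : ⟨u, x + y⟩ = ⟨u, x⟩ + ⟨u, y⟩.
Proof. by rewrite /pairing linearD. Qed.

Lemma pairingNr A (u : dual A) x : ⟨u, - x⟩ = - ⟨u, x⟩.
Proof. by rewrite /pairing linearN. Qed.

Lemma pairingZr A (u : dual A) k x : ⟨u, k *: x⟩ = k * ⟨u, x⟩.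
Proof. by rewrite /pairing linearZ. Qed.

Lemma pairing0r A (u : dual A) : ⟨u, 0⟩ = 0.
Proof. by rewrite /pairing linear0. Qed.

Definition pairing_lin := (pairingDl, pairingNl, pairingZl, pairing0l,
  (pairingDr, pairingNr, pairingZr, pairing0r)).

(** The transpose of [f] applied to [b]; it moves operators off a vector or tensor into the
    functional. *)
Definition pullback A B (b : dual B) (f : 'Hom(A, B)) : dual A := (b \o f)%VF.

Lemma pullbackE A B (b : dual B) (f : 'Hom(A, B)) x :
  ⟨pullback b f, x⟩ = ⟨b, f x⟩.
Proof. by rewrite /pairing comp_lfunE. Qed.

Lemma pullback_id A (a : dual A) : pullback a \1%VF = a.
Proof. exact: comp_lfun1r. Qed.

Lemma pullbackD A B (b : dual B) (f g : 'Hom(A, B)) :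
  pullback b (f + g) = pullback b f + pullback b g.
Proof. exact: comp_lfunDr. Qed.

Lemma pullbackN A B (b : dual B) (f : 'Hom(A, B)) :
  pullback b (- f) = - pullback b f.
Proof. exact: comp_lfunNr. Qed.

Lemma pairing_tmap A B C D (f : 'Hom(A, C)) (g : 'Hom(B, D)) c d t :
  ⟨tpair c d, (f ⊗ g) t⟩ = ⟨tpair (pullback c f) (pullback d g), t⟩.
Proof.
rewrite -pullbackE; congr (⟨_, t⟩); apply: tensor_ext => x y.
(* [tensor_ext] leaves raw applications of linear maps; they are refolded into pairings. *)
by rewrite -![fun_of_lfun _ _]/(⟨_, _⟩) pullbackE tmap_tens !tpair_tens !pullbackE.
Qed.

Lemma pairing_tswap A B (a : dual A) (b : dual B) t :
  ⟨tpair b a, tswap t⟩ = ⟨tpair a b, t⟩.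
Proof.
rewrite -pullbackE; congr (⟨_, t⟩); apply: tensor_ext => x y.
by rewrite -![fun_of_lfun _ _]/(⟨_, _⟩) pullbackE tswap_tens !tpair_tens mulrC.
Qed.

(** For fixed z, composing with the linear map t ↦ t ⊗ z reduces this to [tensor_ext] on A ⊗ B. *)
Lemma tensor_extl A B C D (f g : 'Hom(tensor (tensor A B) C, D)) :
  (forall x y z, f (tens (tens x y) z) = g (tens (tens x y) z)) -> f = g.
Proof.
move=> fg; apply: tensor_ext => t z.
have tl := tens_linearl z : linear (fun t : tensor A B => tens t z).
rewrite -!(linfunP t tl) -!comp_lfunE; congr (fun_of_lfun _ t).
by apply: tensor_ext => x y; rewrite !comp_lfunE !linfunP.
Qed.

Lemma tensor_extr A B C D (f g : 'Hom(tensor A (tensor B C), D)) :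
  (forall x y z, f (tens x (tens y z)) = g (tens x (tens y z))) -> f = g.
Proof.
move=> fg; apply: tensor_ext => x t.
have tl := tens_linearr x : linear (fun t : tensor B C => tens x t).
rewrite -!(linfunP t tl) -!comp_lfunE; congr (fun_of_lfun _ t).
by apply: tensor_ext => y z; rewrite !comp_lfunE !linfunP.
Qed.

Lemma pairing_tassoc A B C (a : dual A) (b : dual B) (c : dual C) t :
  ⟨tpair (tpair a b) c, tassoc A B C t⟩ = ⟨tpair a (tpair b c), t⟩.
Proof.
rewrite -pullbackE; congr (⟨_, t⟩); apply: tensor_extr => x y z.
rewrite -![fun_of_lfun _ _]/(⟨_, _⟩) pullbackE tassoc_tens !tpair_tens.
by rewrite mulrA.
Qed.

Lemma pairing_tassocV A B C (a : dual A) (b : dual B) (c : dual C) t :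
  ⟨tpair a (tpair b c), tassocV A B C t⟩ = ⟨tpair (tpair a b) c, t⟩.
Proof.
rewrite -pullbackE; congr (⟨_, t⟩); apply: tensor_extl => x y z.
rewrite -![fun_of_lfun _ _]/(⟨_, _⟩) pullbackE tassocV_tens !tpair_tens.
by rewrite mulrA.
Qed.

Lemma pullback_tswap A B (a : dual A) (b : dual B) :
  pullback (tpair b a) tswap = tpair a b.
Proof. by apply: dual_ext => t; rewrite pullbackE pairing_tswap. Qed.

(** Products of dual basis vectors read off the matrix coefficients of a tensor. *)
Lemma tpair_sep A B (s t : tensor A B) :
  (forall a b, ⟨tpair a b, s⟩ = ⟨tpair a b, t⟩) -> s = t.
Proof.
pose e V i := mkdual (@stdc K V i).
have eE V i x : ⟨e V i, x⟩ = stdc i x.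
  by rewrite mkdualE // /stdc => *; rewrite linearP.
have pE i j (r : tensor A B) :
    ⟨tpair (e A i) (e B j), r⟩ = (r : 'M[K]_(_, _)) i j.
  pose c (r : tensor A B) : K^o := (r : 'M[K]_(_, _)) i j.
  have cl : linear c by move=> k u v; rewrite /c !mxE.
  rewrite -[RHS](linfunP r cl); suff -> : tpair (e A i) (e B j) = linfun c by [].
  apply: (@tensor_ext K A B K^o) => x y; rewrite (linfunP _ cl).
  by rewrite -[LHS]/(⟨_, tens x y⟩) tpair_tens !eE /c mxE.
by move=> st; apply/matrixP => i j; rewrite -!pE st.
Qed.

(* Contracting the last factor with w reduces this to tpair_sep. *)
Lemma tpair3_sep A B C (s t : tensor (tensor A B) C) :
  (forall a b c,
     ⟨tpair (tpair a b) c, s⟩ = ⟨tpair (tpair a b) c, t⟩) -> s = t.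
Proof.
move=> st; apply: tpair_sep => u w.
pose f (r : tensor A B) (z : C) := ⟨w, z⟩ *: r.
have fE v r : ⟨v, tlift f r⟩ = ⟨tpair v w, r⟩.
  rewrite -pullbackE; congr (⟨_, r⟩); apply: tensor_ext => p z.
  rewrite -![fun_of_lfun _ _]/(⟨_, _⟩) pullbackE tpair_tens tlift_tens.
  - by rewrite pairing_lin mulrC.
  - by move=> y k p1 p2; rewrite /f scalerDr !scalerA [k * _]mulrC.
  - by move=> y k p1 p2; rewrite /f !pairing_lin scalerDl scalerA.
rewrite -!fE; congr (⟨u, _⟩).
by apply: tpair_sep => a b; rewrite !fE.
Qed.

(** The sign in -L^* cancels the one in the dual representation, leaving a plain transpose. *)
Lemma opp_dual_repE A V (rho : 'Hom(A, 'End(V))) x (u : dual V) :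
  (- dual_rep rho) x u = pullback u (rho x).
Proof.
apply: dual_ext => v.
by rewrite !opp_lfunE pairing_lin dual_repE opprK pullbackE.
Qed.

Lemma opp_predual_repE A V (rho : 'Hom(A, 'End(dual V))) x (u : dual V) v :
  ⟨u, (- predual_rep rho) x v⟩ = ⟨rho x u, v⟩.
Proof. by rewrite !opp_lfunE pairing_lin predual_repE opprK. Qed.

Lemma lfun_commutatorE A (m : 'Hom(A, 'End(A))) x :
  commutator m x = m x - lflip m x.
Proof. by rewrite /commutator !(add_lfunE, opp_lfunE). Qed.

Lemma comm_lflip A (m : 'Hom(A, 'End(A))) :
  (forall x y, m x y = m y x) -> lflip m = m.
Proof. by move=> mC; apply/lfunP => x; apply/lfunP => y; rewrite lflipE. Qed.

(** Linear-combination principle: [a = b] is a combination of known identities, and [ring] checks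
    the difference of sides. *)
Lemma eq_of_sub (a b x y : K) : a = b -> x - y = a - b -> x = y.
Proof. by move=> ->; rewrite subrr => /subr0_eq. Qed.

Lemma pairing_congl A (x : A) (u v : dual A) : u = v -> ⟨u, x⟩ = ⟨v, x⟩.
Proof. by move=> ->. Qed.

Lemma eqrD (a b c d : K) : a = b -> c = d -> a + c = b + d.
Proof. by move=> -> ->. Qed.

Lemma eqrM (k a b : K) : a = b -> k * a = k * b.
Proof. by move=> ->. Qed.

End Pairing.

(** The passes are repeated because opening an outer map exposes further sums and composites. *)
Ltac expand :=
  rewrite ?commutatorE;
  do 3 rewrite ?comp_lfunE ?add_lfunE ?opp_lfunE ?scale_lfunE ?id_lfunE
    ?zero_lfunE ?lfunD ?lfunN ?lfunZ;
  do 2 rewrite ?pairingDl ?pairingDr ?pairingNl ?pairingNr ?pairingZl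
    ?pairingZr ?pairing0l ?pairing0r.

Ltac expand_tensor :=
  rewrite ?commutatorE ?lfun_commutatorE; expand;
  do 3 rewrite ?pairing_tassoc ?pairing_tassocV ?pairing_tswap ?pairing_tmap
    ?pullback_id ?pullback_tswap ?pullbackD ?pullbackN.

(** * Sub-adjacent transposed Poisson algebras and their representations on duals *)

Section SubAdjacent.
Variables (K : fieldType) (A : vectType K).
Implicit Types (dot circ : 'Hom(A, 'End(A))).

Lemma commutator_lie circ :
  anti_pre_lie_algebra circ -> lie_algebra (commutator circ).
Proof.
move=> [rep cyc]; split=> [x|x y z]; first by rewrite commutatorE subrr.
apply: dual_sep => u.
have h1 := congr1 (pairing u) (cyc x y z).
have h2 := congr1 (pairing u) (rep x y z).
have h3 := congr1 (pairing u) (rep y z x).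
have h4 := congr1 (pairing u) (rep z x y).
(* With Σ cyclic, [h2]-[h4] add up to Σ x∘[y,z] = -Σ [x,y]∘z. The Jacobi sum is Σ x∘[y,z] - Σ
   [x,y]∘z, which differs by twice the cyclic axiom [h1]. *)
have := eqrD (eqrM (- 2) h1) (eqrD h2 (eqrD h3 h4)).
by expand => h; apply: (eq_of_sub h); ring.
Qed.

Lemma apl_poisson_tp dot circ : 2 != 0 :> K ->
  apl_poisson_algebra dot circ ->
  transposed_poisson_algebra dot (commutator circ).
Proof.
move=> nz2 [[dotC dotA] apl c1 c2].
split=> // [|x y z]; first exact: commutator_lie.
apply: dual_sep => u; apply: (mulfI nz2).
have h1 := congr1 (pairing u) (c1 x y z).
have h2 := congr1 (pairing u) (c2 x y z).
have h3 := congr1 (pairing u) (c2 y x z).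
have h4 := congr1 (pairing u) (c2 x z y).
have h5 := congr1 (pairing u) (c2 y z x).
(* [h1 - h4 + h5] is twice z·[x,y] = x∘(y·z) - y∘(x·z), whence the doubled goal; three times it,
   plus twice [h2 - h3], which brings in (z·x)∘y - (z·y)∘x, is that goal. *)
have := eqrD (eqrD (eqrD (eqrM 2 h2) (eqrM (- 2) h3)) (eqrM 3 h1))
  (eqrD (eqrM (- 3) h4) (eqrM 3 h5)).
rewrite (dotC y z) (dotC x z) (dotC y x) (dotC _ z) [dot (circ y x) z]dotC.
by expand => h; apply: (eq_of_sub h); ring.
Qed.

(** Transposition reverses composition, so the sign in L(x)L(y) - L(y)L(x) = -L([x,y]) for ∘ becomes
    the right one; the other axioms are associativity and the two Poisson compatibilities. *)
Lemma tp_representation_dual dot circ (mu rho : 'Hom(A, 'End(dual A))) :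
  (forall x u, mu x u = pullback u (dot x)) ->
  (forall x u, rho x u = pullback u (circ x)) ->
  apl_poisson_algebra dot circ ->
  tp_representation dot (commutator circ) mu rho.
Proof.
move=> muE rhoE [[dotC dotA] [rep _] c1 c2].
split=> x y; apply/lfunP => a; apply: dual_ext => z.
- by expand; rewrite !muE !pullbackE (dotC x) dotA.
- have := congr1 (pairing a) (rep x y z).
  expand; rewrite !rhoE !pullbackE; expand => h.
  by apply: (eq_of_sub h); ring.
- have := congr1 (pairing a) (c2 y z x).
  expand; rewrite !(muE, rhoE, pullbackE) (dotC z x) => h.
  by apply: (eq_of_sub h); ring.
have := congr1 (pairing a) (c1 x y z).
expand; rewrite !(muE, rhoE, pullbackE); expand => h.
by apply: (eq_of_sub h); ring.
Qed.

(** The same argument with A as the dual of A*: each axiom of A* is evaluated at a vector of A. *)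
Lemma tp_representation_predual (dot circ : 'Hom(dual A, 'End(dual A)))
    (mu rho : 'Hom(dual A, 'End(A))) :
  (forall a b x, ⟨b, mu a x⟩ = ⟨dot a b, x⟩) ->
  (forall a b x, ⟨b, rho a x⟩ = ⟨circ a b, x⟩) ->
  apl_poisson_algebra dot circ ->
  tp_representation dot (commutator circ) mu rho.
Proof.
move=> muE rhoE [[dotC dotA] [rep _] c1 c2].
split=> a b; apply/lfunP => x; apply: dual_sep => c.
- by expand; rewrite !muE (dotC a) dotA.
- have := pairing_congl x (rep a b c).
  by expand; rewrite !rhoE; expand => h; apply: (eq_of_sub h); ring.
- have := pairing_congl x (c2 b c a).
  expand; rewrite !(muE, rhoE) (dotC c a) => h.
  by apply: (eq_of_sub h); ring.
have := pairing_congl x (c1 a b c).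
by expand; rewrite !(muE, rhoE); expand => h; apply: (eq_of_sub h); ring.
Qed.

End SubAdjacent.

(** * Coalgebra axioms and compatibility conditions as scalar identities *)

Section Dualization.
Variables (K : fieldType) (A : vectType K).
Variables (dotS circS : 'Hom(dual A, 'End(dual A))).
Variables (Delta delta : 'Hom(A, tensor A A)).
Hypothesis hDelta : linear_dual dotS Delta.
Hypothesis hdelta : linear_dual circS delta.

Lemma pullback_linear_dual m (D : 'Hom(A, tensor A A)) a b :
  linear_dual m D -> pullback (tpair a b) D = m a b.
Proof. by move=> mD; apply: dual_ext => x; rewrite pullbackE mD. Qed.

Let pD a b : pullback (tpair a b) Delta = dotS a b.
Proof. exact: pullback_linear_dual. Qed.
Let pd a b : pullback (tpair a b) delta = circS a b.
Proof. exact: pullback_linear_dual. Qed.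

(** [pD] and [pd] absorb the inner coproduct of a threefold tensor, [hDelta] and [hdelta] the outer
    one. *)
Local Ltac dualize :=
  expand_tensor; rewrite ?(pD, pd, =^~ hDelta, =^~ hdelta); expand.

(** Paired with a ⊗ b ⊗ c (or a ⊗ b), each coalgebra axiom is an algebra axiom of A* evaluated at
    x. *)
Lemma linear_dual_coalgebra :
  apl_poisson_algebra dotS circS -> apl_poisson_coalgebra Delta delta.
Proof.
move=> [[dotC dotA] [rep cyc] c1 c2]; split.
- split; apply/lfunP => x.
    by apply: tpair_sep => a b; dualize; rewrite dotC.
  by apply: tpair3_sep => a b c; dualize; rewrite dotA.
- split; apply/lfunP => x; apply: tpair3_sep => a b c.
    have := pairing_congl x (rep a b c).
    by dualize => h; apply: (eq_of_sub h); ring.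
  have := pairing_congl x (cyc a b c).
  (* τ ⊗ id - id yields [b,a]∘c, hence the sign. *)
  by dualize => h; apply: (eq_of_sub (eqrM (-1) h)); ring.
- apply/lfunP => x; apply: tpair3_sep => a b c.
  have := pairing_congl x (c1 a b c).
  by dualize => h; apply: (eq_of_sub h); ring.
apply/lfunP => x; apply: tpair3_sep => a b c.
have := pairing_congl x (c2 a b c).
dualize; rewrite (dotC c a) [dotS c _]dotC => h.
by apply: (eq_of_sub h); ring.
Qed.

Variables (dot circ : 'Hom(A, 'End(A))).
Variables (muA rhoA : 'Hom(A, 'End(dual A))).
Variables (muB rhoB : 'Hom(dual A, 'End(A))).
Hypothesis muAE : forall x u, muA x u = pullback u (dot x).
Hypothesis rhoAE : forall x u, rhoA x u = pullback u (circ x).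
Hypothesis muBE : forall a b x, ⟨b, muB a x⟩ = ⟨dotS a b, x⟩.
Hypothesis rhoBE : forall a b x, ⟨b, rhoB a x⟩ = ⟨circS a b, x⟩.
Hypothesis dotC : forall x y, dot x y = dot y x.
Hypothesis dotSC : forall a b, dotS a b = dotS b a.

(** Transposing the outer operator first leaves a product of A* evaluated at x; when the action sits
    in a left argument, that operator is a right multiplication, hence [lflip] below. *)
Let muB_arg (m : 'End(A)) a b x :
  ⟨b, m (muB a x)⟩ = ⟨dotS a (pullback b m), x⟩.
Proof. by rewrite -pullbackE muBE. Qed.

Let rhoB_arg (m : 'End(A)) a b x :
  ⟨b, m (rhoB a x)⟩ = ⟨circS a (pullback b m), x⟩.
Proof. by rewrite -pullbackE rhoBE. Qed.

Let muB_argl (m : 'Hom(A, 'End(A))) a b x y :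
  ⟨b, m (muB a x) y⟩ = ⟨dotS a (pullback b (lflip m y)), x⟩.
Proof. by rewrite -lflipE muB_arg. Qed.

Let rhoB_argl (m : 'Hom(A, 'End(A))) a b x y :
  ⟨b, m (rhoB a x) y⟩ = ⟨circS a (pullback b (lflip m y)), x⟩.
Proof. by rewrite -lflipE rhoB_arg. Qed.

Local Ltac transport :=
  expand; rewrite ?muAE ?rhoAE ?pullbackE ?muBE ?rhoBE ?muB_argl ?rhoB_argl
    ?muB_arg ?rhoB_arg ?(comm_lflip dotC).

Lemma inf_compatA :
  (forall x y, Delta (dot x y)
     = (dot x ⊗ \1%VF) (Delta y) + (\1%VF ⊗ dot y) (Delta x)) <->
  (forall x a b, muA x (dotS a b) = dotS (muA x a) b + muA (muB a x) b).
Proof.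
split=> H => [x a b|x y].
  apply: dual_ext => y; have := congr1 (pairing (tpair a b)) (H x y).
  by dualize; transport.
apply: tpair_sep => a b; have := pairing_congl y (H x a b).
by dualize; transport.
Qed.

(** The scalar identity of [inf_compatA] again, now tested against b in A* instead of y in A. *)
Lemma inf_compatB :
  (forall x y, Delta (dot x y)
     = (dot x ⊗ \1%VF) (Delta y) + (\1%VF ⊗ dot y) (Delta x)) ->
  (forall a x y, muB a (dot x y) = dot (muB a x) y + muB (muA x a) y).
Proof.
move=> H a x y; apply: dual_sep => b.
have := congr1 (pairing (tpair a b)) (H x y).
by dualize; transport; rewrite addrC.
Qed.

(** Paired with a ⊗ b, the factor id - τ becomes the commutator on A*, and R(y) on δ(x) becomes an
    action of [rhoB a x]. *)
Lemma apl_compat1 :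
  (forall x y, (\1 - tswap)%VF
      (delta (circ x y) - (circ x ⊗ \1%VF) (delta y)
       - (\1%VF ⊗ circ x) (delta y)
       + (\1%VF ⊗ lflip circ y) (delta x)) = 0) <->
  (forall x a b, rhoA x (commutator circS a b)
      - commutator circS (rhoA x a) b - commutator circS a (rhoA x b)
      + rhoA (rhoB a x) b - rhoA (rhoB b x) a = 0).
Proof.
split=> H => [x a b|x y].
  apply: dual_ext => y; have := congr1 (pairing (tpair a b)) (H x y).
  by dualize; transport => h; apply: (eq_of_sub h); ring.
apply: tpair_sep => a b; have := pairing_congl y (H x a b).
by dualize; transport => h; apply: (eq_of_sub h); ring.
Qed.

Lemma apl_compat2 :
  (forall x y, delta (commutator circ x y)
    = (\1%VF ⊗ commutator circ x - circ x ⊗ \1%VF)%VF (delta y)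
      - (\1%VF ⊗ commutator circ y - circ y ⊗ \1%VF)%VF (delta x)) <->
  (forall a x y, rhoB a (commutator circ x y)
      - commutator circ (rhoB a x) y - commutator circ x (rhoB a y)
      + rhoB (rhoA x a) y - rhoB (rhoA y a) x = 0).
Proof.
split=> H => [a x y|x y].
  apply: dual_sep => b; have := congr1 (pairing (tpair a b)) (H x y).
  by dualize; transport => h; apply: (eq_of_sub h); ring.
apply: tpair_sep => a b; have := congr1 (pairing b) (H a x y).
by dualize; transport => h; apply: (eq_of_sub h); ring.
Qed.

Lemma poisson_compat1 :
  (forall x y, 2 *: (circ x ⊗ \1%VF) (Delta y) - 2 *: (\1%VF ⊗ dot y) (delta x)
      + delta (dot x y) + (dot y ⊗ \1%VF) (delta x)
      - (\1%VF ⊗ commutator circ x) (Delta y) = 0) <->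
  (forall x y a, 2 *: muB (rhoA y a) x - 2 *: dot x (rhoB a y)
    = - rhoB a (dot x y) - rhoB (muA x a) y + commutator circ y (muB a x)).
Proof.
split=> H => [x y a|x y].
  (* x and y trade places: (B1) has ∘ acting by x, the matched pair by y. *)
  apply: dual_sep => b; have := congr1 (pairing (tpair a b)) (H y x).
  dualize; transport; rewrite (dotC y x) => h.
  by apply: (eq_of_sub h); ring.
apply: tpair_sep => a b; have := congr1 (pairing b) (H y x a).
dualize; transport; rewrite (dotC y x) => h.
by apply: (eq_of_sub h); ring.
Qed.

Lemma poisson_compat2 :
  (forall x y, 2 *: Delta (commutator circ x y)
      + (\1%VF ⊗ commutator circ y) (Delta x)
      - (dot x ⊗ \1%VF) (delta y) - (\1%VF ⊗ commutator circ x) (Delta y)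
      + (dot y ⊗ \1%VF) (delta x) = 0) <->
  (forall x y a, 2 *: muB a (commutator circ x y)
    = commutator circ (muB a x) y + rhoB (muA x a) y
      + commutator circ x (muB a y) - rhoB (muA y a) x).
Proof.
split=> H => [x y a|x y].
  apply: dual_sep => b; have := congr1 (pairing (tpair a b)) (H x y).
  by dualize; transport => h; apply: (eq_of_sub h); ring.
apply: tpair_sep => a b; have := congr1 (pairing b) (H x y a).
by dualize; transport => h; apply: (eq_of_sub h); ring.
Qed.

Lemma poisson_compat3 :
  (forall x y, 2 *: (\1%VF ⊗ dot y) (delta x) - 2 *: (circ x ⊗ \1%VF) (Delta y)
      + Delta (circ x y) + (lflip circ y ⊗ \1%VF) (Delta x)
      + tswap ((dot x ⊗ \1%VF) (delta y)) - (\1%VF ⊗ dot x) (delta y) = 0) <->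
  (forall x a b, 2 *: muA (rhoB b x) a - 2 *: dotS a (rhoA x b)
    = - rhoA x (dotS a b) - rhoA (muB a x) b + commutator circS b (muA x a)).
Proof.
split=> H => [x a b|x y].
  (* The order b ⊗ a matches the term [muA (rhoB b x) a]; commutativity of [dotS] reorders the
     rest. *)
  apply: dual_ext => y; have := congr1 (pairing (tpair b a)) (H x y).
  dualize; transport.
  rewrite (dotSC b a) (dotSC _ a) (dotSC _ a) => h.
  by apply: (eq_of_sub h); ring.
apply: tpair_sep => a b; have := pairing_congl y (H x b a).
dualize; transport; rewrite (dotSC b a) (dotSC b) (dotSC b) => h.
by apply: (eq_of_sub h); ring.
Qed.

Lemma poisson_compat4 :
  (forall x y, (tswap - \1)%VF
      (2 *: delta (dot x y) - (dot x ⊗ \1%VF) (delta y)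
       - (\1%VF ⊗ dot x) (delta y)
       - (\1%VF ⊗ lflip circ y) (Delta x)) = 0) <->
  (forall x a b, 2 *: muA x (commutator circS a b)
    = commutator circS (muA x a) b + rhoA (muB a x) b
      + commutator circS a (muA x b) - rhoA (muB b x) a).
Proof.
split=> H => [x a b|x y].
  apply: dual_ext => y; have := congr1 (pairing (tpair a b)) (H x y).
  (* τ - id gives the negative of the commutator. *)
  by dualize; transport => h; apply: (eq_of_sub (eqrM (-1) h)); ring.
apply: tpair_sep => a b; have := pairing_congl y (H x a b).
by dualize; transport => h; apply: (eq_of_sub (eqrM (-1) h)); ring.
Qed.

End Dualization.

(** * Assembly of the equivalence *)

Theorem theorem3p31 (K : closedFieldType) (charK0 : [pchar K] =i pred0)
    (A : vectType K)
    (dot circ : 'Hom(A, 'End(A)))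
    (dotS circS : 'Hom(dual A, 'End(dual A)))
    (Delta delta : 'Hom(A, tensor A A))
    (hA : apl_poisson_algebra dot circ)
    (hAS : apl_poisson_algebra dotS circS)
    (hDelta : linear_dual dotS Delta)
    (hdelta : linear_dual circS delta) :
  apl_poisson_bialgebra dot circ Delta delta
  <->
  tp_matched_pair dot (commutator circ) dotS (commutator circS)
    (- dual_rep dot) (- dual_rep circ)
    (- predual_rep dotS) (- predual_rep circS).
Proof.
have nz2 : 2 != 0 :> K by rewrite ((pcharf0P K).1 charK0).
have muAE := opp_dual_repE dot; have rhoAE := opp_dual_repE circ.
have muBE a b x := opp_predual_repE dotS a b x.
have rhoBE a b x := opp_predual_repE circS a b x.
have dotC := ca_comm (aplp_ca hA); have dotSC := ca_comm (aplp_ca hAS).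
have tpA := apl_poisson_tp nz2 hA; have tpS := apl_poisson_tp nz2 hAS.
have repA := tp_representation_dual muAE rhoAE hA.
have repS := tp_representation_predual muBE rhoBE hAS.
have coA := linear_dual_coalgebra hDelta hdelta hAS.
have ib := inf_compatA hDelta muAE muBE dotC.
have ibB := inf_compatB hDelta muAE muBE dotC.
have ac1 := apl_compat1 hdelta rhoAE rhoBE.
have ac2 := apl_compat2 hdelta rhoAE rhoBE.
have B1 := poisson_compat1 hDelta hdelta muAE rhoAE muBE rhoBE dotC.
have B2 := poisson_compat2 hDelta hdelta circ muAE muBE rhoBE.
have B3 := poisson_compat3 hDelta hdelta muAE rhoAE muBE rhoBE dotC dotSC.
have B4 := poisson_compat4 hDelta hdelta muAE rhoAE muBE.
(* Seven conditions [h0]-[h6] are extracted from either side; [cam_compatB] is obtained from [h0]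
   through [ibB]. *)
split=> [[_ _ [_ _ h0] [_ _ h1 h2] h3 h4 h5 h6]|
         [_ _ [_ _ _ _ h0 _] [_ _ _ _ h1 h2] _ _ h3 h4 h5 h6]].
  split=> //; [split=> //|split=> //| | | |].
  - exact: tp_ca tpA.
  - exact: tp_ca tpS.
  - exact: tpr_ca repA.
  - exact: tpr_ca repS.
  - exact/ib.
  - exact: ibB h0.
  - exact: tp_lie tpA.
  - exact: tp_lie tpS.
  - exact: tpr_lie repA.
  - exact: tpr_lie repS.
  - exact/ac1.
  - exact/ac2.
  - exact/B1.
  - exact/B2.
  - exact/B3.
  - exact/B4.
split=> //; [split=> //|split=> //| | | |].
- exact: aplp_ca hA.
- exact: aplpc_cc coA.
- exact/ib.
- exact: aplp_apl hA.
- exact: aplpc_apl coA.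
- exact/ac1.
- exact/ac2.
- exact/B1.
- exact/B2.
- exact/B3.
- exact/B4.
Qed.
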